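(* Let $s\ge 1$, let $a_{ij},b_i\in\mathbb{R}$ ($i,j=1,\dots,s$) be Runge--Kutta coefficients with $c_i=\sum_{j=1}^s a_{ij}$, and suppose that $$b_ia_{ij}+b_ja_{ji}=b_ib_j\qquad\text{for all } i,j=1,\dots,s.$$ Let $M>0$ be an integer and let $u^0,u^1,u^2,\dots$ be produced with time step $\tau>0$ by the following prediction-correction scheme (Scheme 2.2). For each $n\ge0$, given $u^n$: 1. Prediction: set $k_i^{n,0}=u^n$ for $i=1,\dots,s$, and for $m=0,1,\dots,M-1$ compute $$u_i^{n,m}=u^n+\tau\sum_{j=1}^s a_{ij}k_j^{n,m},\qquad k_i^{n,m+1}=\mathcal{D}^{-1}\mathcal{G}(u_i^{n,m})u_i^{n,m},\qquad i=1,\dots,s;$$ then set $u_i^{n,*}=u_i^{n,M}:=u^n+\tau\sum_{j=1}^s a_{ij}k_j^{n,M}$. 2. Correction: the stages $u_i^n$, $k_i^n$ and $u^{n+1}$ satisfy $$k_i^n=\mathcal{D}^{-1}\mathcal{G}(u_i^{n,*})u_i^n,\qquad u_i^n=u^n+\tau\sum_{j=1}^s a_{ij}k_j^n,\qquad i=1,\dots,s,$$ $$u^{n+1}=u^n+\tau\sum_{i=1}^s b_ik_i^n.$$ Then the scheme exactly conserves the semi-discrete momentum: $$I^{n+1}=I^n,\qquad I^n:=\tfrac12\,(u^n,\mathcal{D}u^n),\qquad n=0,1,2,\dots$$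
   Context: Setting: the regularized long-wave equation $\partial_tu+\alpha\partial_xu+\beta\partial_yu+\alpha u\partial_xu+\beta u\partial_yu-\mu\partial_{xxt}u-\theta\partial_{yyt}u=0$ on $\Omega=[a,b]\times[c,d]$ with periodic boundary conditions, where $\alpha,\beta\in\mathbb{R}$, $\mu>0$, $\theta>0$ are constants. All functions of $\mathbf{x}=(x,y)$ are real-valued, periodic on $\Omega$ and smooth; the scheme is discrete in time only. $(u,v)=\int_\Omega uv\,d\mathbf{x}$. $\mathcal{D}=1-\mu\partial_{xx}-\theta\partial_{yy}$, which is self-adjoint and invertible on periodic functions. For a function $w$, $\mathcal{G}(w)$ is the linear operator $$\mathcal{G}(w)v=-\Big[\alpha\partial_xv+\beta\partial_yv+\tfrac{\alpha}{3}\big(w\,\partial_xv+\partial_x(wv)\big)+\tfrac{\beta}{3}\big(w\,\partial_yv+\partial_y(wv)\big)\Big].$$ The equation is equivalent to $\mathcal{D}u_t=\mathcal{G}(u)u$. Time grid: $t_n=n\tau$, $t_{ni}=t_n+c_i\tau$, with $c_1,\dots,c_s$ distinct real numbers; $u^n$ and $u_i^n$ approximate $u$ at $t_n$ and $t_{ni}$. *)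

(* Defs.v *)
From HB Require Import structures.
From mathcomp Require Import all_boot all_order all_algebra.
From mathcomp Require Import all_classical all_reals all_analysis.
Set Implicit Arguments.
Unset Strict Implicit.
Unset Printing Implicit Defensive.
Import Order.TTheory GRing.Theory Num.Theory numFieldNormedType.Exports.
Local Open Scope classical_set_scope.
Local Open Scope ring_scope.

(* Functions periodic on Omega = [a, b] x [c, d] are represented by their
   periodic extensions to the whole plane. *)

Definition e1 {R : realType} : R * R := (1, 0).
Definition e2 {R : realType} : R * R := (0, 1).

Definition dx {R : realType} (u : R * R -> R) : R * R -> R :=
  fun p => 'D_e1 u p.
Definition dy {R : realType} (u : R * R -> R) : R * R -> R :=
  fun p => 'D_e2 u p.

(* All iterated partial derivatives of order at most n exist everywhere and
   are continuous. *)
Fixpoint Cn {R : realType} (n : nat) (u : R * R -> R) : Prop :=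
  if n is m.+1 then
    [/\ continuous u,
        forall p, derivable u p e1, forall p, derivable u p e2,
        Cn m (dx u) & Cn m (dy u)]
  else continuous u.

Definition smooth {R : realType} (u : R * R -> R) : Prop :=
  forall n, Cn n u.

Definition periodic {R : realType} (a b c d : R) (u : R * R -> R) : Prop :=
  forall p, u (p.1 + (b - a), p.2) = u p /\ u (p.1, p.2 + (d - c)) = u p.

Definition smooth_periodic {R : realType} (a b c d : R) : set (R * R -> R) :=
  [set u | smooth u /\ periodic a b c d u].

Definition inner {R : realType} (a b c d : R) (u v : R * R -> R) : R :=
  \int[(@lebesgue_measure R \x @lebesgue_measure R)%E]_(p in
      `[a, b] `*` `[c, d]) (u p * v p).

Definition opD {R : realType} (mu theta : R) (u : R * R -> R) : R * R -> R :=
  fun p => u p - mu * dx (dx u) p - theta * dy (dy u) p.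

(* opD, as an operator on smooth periodic functions, is a bijection onto the
   smooth periodic functions when mu, theta > 0; the value 0 that 'pinv_
   returns outside its image is therefore never attained on such functions. *)
Definition opDinv {R : realType} (a b c d mu theta : R) :
    (R * R -> R) -> R * R -> R :=
  'pinv_(fun=> 0) (smooth_periodic a b c d) (opD mu theta).

Definition opG {R : realType} (alpha beta : R) (w v : R * R -> R) :
    R * R -> R :=
  fun p => - (alpha * dx v p + beta * dy v p
              + alpha / 3 * (w p * dx v p + dx (fun q => w q * v q) p)
              + beta / 3 * (w p * dy v p + dy (fun q => w q * v q) p)).

Definition momentum {R : realType} (a b c d mu theta : R) (u : R * R -> R) : R :=
  2^-1 * inner a b c d u (opD mu theta u).

Definition rk_stage {R : realType} (s : nat) (A : 'M[R]_s) (tau : R)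
    (un : R * R -> R) (k : 'I_s -> R * R -> R) (i : 'I_s) : R * R -> R :=
  un + tau *: \sum_(j < s) A i j *: k j.

Fixpoint predicted_slope {R : realType} (a b c d alpha beta mu theta : R)
    (s : nat) (A : 'M[R]_s) (tau : R) (un : R * R -> R) (m : nat) :
    'I_s -> R * R -> R :=
  if m is m'.+1 then
    fun i =>
      let ui := rk_stage A tau un
        (predicted_slope a b c d alpha beta mu theta A tau un m') i in
      opDinv a b c d mu theta (opG alpha beta ui ui)
  else fun=> un.

Definition predicted_stage {R : realType} (a b c d alpha beta mu theta : R)
    (s : nat) (A : 'M[R]_s) (tau : R) (un : R * R -> R) (M : nat) :
    'I_s -> R * R -> R :=
  rk_stage A tau un (predicted_slope a b c d alpha beta mu theta A tau un M).

(* u is the sequence of numerical solutions; U n i and K n i are the stages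
   u_i^n and k_i^n of the correction step, which is a linear system for them
   that the sequences are required to satisfy. *)
Definition prediction_correction {R : realType}
    (a b c d alpha beta mu theta : R)
    (s : nat) (A : 'M[R]_s) (w : 'I_s -> R) (tau : R) (M : nat)
    (u : nat -> R * R -> R) (U K : nat -> 'I_s -> R * R -> R) : Prop :=
  forall n,
    [/\ forall i, K n i = opDinv a b c d mu theta
          (opG alpha beta
             (predicted_stage a b c d alpha beta mu theta A tau (u n) M i)
             (U n i)),
        forall i, U n i = rk_stage A tau (u n) (K n) i &
        u n.+1 = u n + tau *: \sum_(i < s) w i *: K n i].

(* Main.v *)
Require Import Defs.
From mathcomp Require Import all_boot all_order all_algebra.
From mathcomp Require Import all_classical all_reals all_analysis.
From mathcomp Require Import ring lra.
Set Implicit Arguments.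
Unset Strict Implicit.
Unset Printing Implicit Defensive.
Import Order.TTheory GRing.Theory Num.Theory numFieldNormedType.Exports.
Local Open Scope classical_set_scope.
Local Open Scope ring_scope.

(** Write B(u, v) = (u, D v) with D = 1 - mu d_xx - theta d_yy.  On smooth
periodic functions the integral over the rectangle of an x- or y-derivative
vanishes, so dx and dy are skew for the inner product ([inner_dx],
[inner_dy]).  Two consequences carry the proof.

- B(u, v) = (u, v) + mu (dx u, dx v) + theta (dy u, dy v), so B is symmetric
  ([inner_opD], [inner_opDC]).
- (v, G(w) v) = 0 for every smooth periodic w ([inner_opG_skew]): the
  map sending v to w dx v + dx (w v) is twice the skew part of the map sending
  v to w dx v, whatever w is, so the predicted stage may serve as w.

Since D k_i = G(w_i) u_i with w_i the predicted stage, the second fact says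
B(k_i, u_i) = 0 at each stage.  From here the argument is Cooper's theorem: a
Runge-Kutta method with b_i a_ij + b_j a_ji = b_i b_j preserves every quadratic
form whose polar form vanishes on the pairs (k_i, u_i)
([runge_kutta_form_conserved]).

The inverse of D is handled by cases.  Either G(w) v has a smooth periodic
preimage under D, and D D^-1 G(w) v = G(w) v; or it has none, D^-1
takes the value 0 there, and the orthogonality to v is trivial
([inner_opD_opDinv_skew]).

The vanishing of the integral of a derivative is Fubini's theorem followed by
the fundamental theorem of calculus on each line.  Fubini asks for
integrability with respect to the product measure, hence for measurability of
continuous functions of two variables with respect to the product
sigma-algebra ([continuous_measurable_plane]). *)

(** * Measurability and integrability of continuous functions of the plane *)

Notation plane R := (measurableTypeR R * measurableTypeR R)%type.
Notation area R := (@lebesgue_measure R \x @lebesgue_measure R)%E.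

(** The product sigma-algebra contains the open sets because the plane is second
countable: an open set is the union of the rectangles with rational corners
that it contains, and there are countably many of those. *)
Lemma open_measurable_plane (R : realType) (U : set (R * R)) :
  open U -> measurable (U : set (plane R)).
Proof.
move=> oU.
pose box (q : (rat * rat) * (rat * rat)) : set (R * R) :=
  `]ratr q.1.1, ratr q.1.2[ `*` `]ratr q.2.1, ratr q.2.2[.
have -> : U = \bigcup_q (if pselect (box q `<=` U) then box q else set0).
  apply/seteqP; split=> [[x y] Uxy|p [q _]]; last first.
    by case: pselect => // qU /qU.
  have /nbhs_ballP[e /= e0 eU] : nbhs (x, y) U by exact: open_nbhs_nbhs.
  have near_rat (z : R) : exists q : rat * rat,
      (z \in `]ratr q.1, ratr q.2[) /\ `]ratr q.1, ratr q.2[ `<=` ball z e.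
    have /rat_in_itvoo[q1] : z - e < z by rewrite ltrBlDr ltrDl.
    have /rat_in_itvoo[q2] : z < z + e by rewrite ltrDl.
    rewrite !in_itv/= => /andP[zq2 q2e] /andP[eq1 q1z].
    exists (q1, q2); split; first by rewrite in_itv/= q1z zq2.
    move=> t; rewrite /= in_itv/= /ball/= => /andP[q1t tq2].
    by rewrite ltr_distlC (lt_trans eq1 q1t) (lt_trans tq2 q2e).
  have [q [xq qx]] := near_rat x; have [r [yr ry]] := near_rat y.
  exists (q, r) => //; case: pselect => [?|]; first by split.
  by case=> -[s t] [/= /qx sx /ry ty]; apply: eU; split.
apply: countable_bigcupT_measurable => // q.
case: pselect => [?|?]; last exact: measurable0.
by apply: measurableX; exact: measurable_itv.
Qed.

Lemma continuous_measurable_plane (R : realType) (f : R * R -> R) :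
  continuous f -> measurable_fun (setT : set (plane R)) (f : plane R -> R).
Proof.
move=> /continuousP cf.
apply: (measurability _ (measurable_realfun.RGenOpens.measurableE R)).
move=> _ [_ [a [b ->] <-]]; rewrite setTI.
apply: open_measurable_plane; apply: (cf `]a, b[%classic).
exact: (@interval_open R).
Qed.

Lemma measurable_box (R : realType) (a b c d : R) :
  measurable (`[a, b] `*` `[c, d] : set (plane R)).
Proof. by apply: measurableX; exact: measurable_itv. Qed.

Lemma continuous_integrable_box (R : realType) (a b c d : R) (f : R * R -> R) :
  continuous f ->
  (area R).-integrable (`[a, b] `*` `[c, d]) (EFin \o (f : plane R -> R)).
Proof.
move=> cf; apply: measurable_bounded_integrable.
- exact: measurable_box.
- rewrite [X in (X < _)%E]product_measure1E; [|exact: measurable_itv..].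
  apply: lte_mul_pinfty; rewrite ?measure_ge0// ?ge0_fin_numE ?measure_ge0//;
    exact/compact_finite_measure/segment_compact.
- apply: measurable_funTS; exact: continuous_measurable_plane.
- have /compact_bounded[M [_ mrt]] : compact (f @` (`[a, b] `*` `[c, d])).
    apply: continuous_compact; first exact: continuous_subspaceT.
    by apply: compact_setX; exact: segment_compact.
  exists M; split; rewrite ?num_real // => r Mr p Dp.
  by apply: mrt => //; exists p.
Qed.

(** * Derivatives along a line *)

Section directional.
Context (R : realType).
Implicit Types (F : R * R -> R) (p v : R * R).

(** Links a partial derivative in the plane to a derivative of a function of one
variable, where the fundamental theorem of calculus applies. *)
Lemma derive_line F p v (t : R) : derivable F (p + t *: v) v ->
  is_derive t 1 (fun r : R => F (p + r *: v)) ('D_v F (p + t *: v)).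
Proof.
move=> dF.
have quotE :
    (fun h : R => h^-1 *:
      (((fun r : R => F (p + r *: v)) \o shift t) (h *: 1) - F (p + t *: v))) =
    (fun h => h^-1 *:
      ((F \o shift (p + t *: v)) (h *: v) - F (p + t *: v))).
  apply/funext => h; rewrite /= scaler1 scalerDl.
  by congr (_ *: (F _ - _)); rewrite addrCA.
by split; rewrite /derivable /derive quotE.
Qed.

Lemma derive_translate F v w p : (forall q, F (q + w) = F q) ->
  'D_v F (p + w) = 'D_v F p.
Proof.
move=> Fw; rewrite /derive.
suff -> : (fun h => h^-1 *: ((F \o shift (p + w)) (h *: v) - F (p + w))) =
          (fun h => h^-1 *: ((F \o shift p) (h *: v) - F p)) by [].
by apply/funext => h /=; rewrite addrA !Fw.
Qed.

Lemma integral_derive_line F p v (a b : R) : a < b ->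
  (forall q, derivable F q v) -> continuous F -> continuous ('D_v F) ->
  F (p + b *: v) = F (p + a *: v) ->
  (\int[@lebesgue_measure R]_(t in `[a, b]) ('D_v F (p + t *: v))%:E = 0)%E.
Proof.
move=> ab dF cF cDF Fab.
have cline : continuous (fun t : R => p + t *: v).
  move=> t; apply: (@continuousD R (R * R)%type R (cst p) (fun r => r *: v)).
    exact: cst_continuous.
  exact: scalel_continuous.
have cFline : continuous (fun t : R => F (p + t *: v)).
  by move=> t; apply: continuous_comp; [exact: cline|exact: cF].
rewrite (@continuous_FTC2 _ _ (fun t => F (p + t *: v))) ?Fab ?subee//.
- apply: continuous_subspaceT => t.
  apply: (@continuous_comp _ _ _ (fun r : R => p + r *: v) ('D_v F)).
    exact: cline.
  exact: cDF.
- split=> [t _||].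
  + by have [] := derive_line (dF (p + t *: v)).
  + exact/cvg_at_right_filter/cFline.
  + exact/cvg_at_left_filter/cFline.
- by move=> t _; rewrite derive1E; have [_ ->] := derive_line (dF (p + t *: v)).
Qed.

End directional.

(** * Integrals over the rectangle *)

Section box_integral.
Context (R : realType) (a b c d : R).
Implicit Types f g F : R * R -> R.

Definition box_integral f : R :=
  \int[area R]_(p in `[a, b] `*` `[c, d]) f p.

Lemma box_integralD f g : continuous f -> continuous g ->
  box_integral (f + g) = box_integral f + box_integral g.
Proof.
move=> cf cg; apply: RintegralD; first exact: measurable_box.
- exact: continuous_integrable_box.
- exact: continuous_integrable_box.
Qed.

Lemma box_integralZ (k : R) f : continuous f ->
  box_integral (k *: f) = k * box_integral f.
Proof.
move=> cf; apply: RintegralZl; first exact: measurable_box.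
exact: continuous_integrable_box.
Qed.

Let integrable_restriction f : continuous f ->
  (area R).-integrable setT ((EFin \o f) \_ (`[a, b] `*` `[c, d])).
Proof.
move=> cf; apply/(integrable_restrict _ (measurable_box a b c d)) => //.
by rewrite setTI; exact: continuous_integrable_box.
Qed.

(** The two orders of integration in Fubini's theorem, each in the form in which
the inner integral already vanishes. *)
Lemma box_integral_eq0x f : continuous f ->
  (forall y, (\int[@lebesgue_measure R]_(x in `[a, b]) (f (x, y))%:E = 0)%E) ->
  box_integral f = 0.
Proof.
move=> cf f0; rewrite /box_integral /Rintegral integral_mkcond.
rewrite -integral21_prod_meas1; last exact: integrable_restriction.
rewrite integral0_eq// => y _; rewrite /fubini_G.
have [ycd|ycd] := boolP (y \in `[c, d]%classic).
  rewrite -[RHS](f0 y) [RHS]integral_mkcond; apply: eq_integral => x _.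
  by rewrite !patchE in_setX /= ycd andbT.
by rewrite integral0_eq// => x _; rewrite patchE in_setX /= (negbTE ycd) andbF.
Qed.

Lemma box_integral_eq0y f : continuous f ->
  (forall x, (\int[@lebesgue_measure R]_(y in `[c, d]) (f (x, y))%:E = 0)%E) ->
  box_integral f = 0.
Proof.
move=> cf f0; rewrite /box_integral /Rintegral integral_mkcond.
rewrite -integral12_prod_meas1; last exact: integrable_restriction.
rewrite integral0_eq// => x _; rewrite /fubini_F.
have [xab|xab] := boolP (x \in `[a, b]%classic).
  rewrite -[RHS](f0 x) [RHS]integral_mkcond; apply: eq_integral => y _.
  by rewrite !patchE in_setX /= xab.
by rewrite integral0_eq// => y _; rewrite patchE in_setX /= (negbTE xab).
Qed.

Hypotheses (ab : a < b) (cd : c < d).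

Lemma box_integral_dx F : Defs.periodic a b c d F -> (forall p, derivable F p e1) ->
  continuous F -> continuous (dx F) -> box_integral (dx F) = 0.
Proof.
move=> pF dF cF cdF; apply: box_integral_eq0x => // y.
have line (t : R) : (t, y) = (0, y) + t *: e1 :> R * R.
  by congr pair; rewrite /= ?scaler0 ?addr0 ?add0r //; exact/esym/mulr1.
under eq_integral do rewrite line.
apply: integral_derive_line => //; rewrite -!line.
by have [] := pF (a, y); rewrite /= addrC subrK.
Qed.

Lemma box_integral_dy F : Defs.periodic a b c d F -> (forall p, derivable F p e2) ->
  continuous F -> continuous (dy F) -> box_integral (dy F) = 0.
Proof.
move=> pF dF cF cdF; apply: box_integral_eq0y => // x.
have line (t : R) : (x, t) = (x, 0) + t *: e2 :> R * R.
  by congr pair; rewrite /= ?scaler0 ?addr0 ?add0r //; exact/esym/mulr1.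
under eq_integral do rewrite line.
apply: integral_derive_line => //; rewrite -!line.
by have [] := pF (x, c); rewrite /= [c + _]addrC subrK.
Qed.

End box_integral.

(** * Stability properties of smooth periodic functions *)

Section smooth_periodic_functions.
Context (R : realType).
Implicit Types u v : R * R -> R.

Lemma dxD u v : (forall p, derivable u p e1) -> (forall p, derivable v p e1) ->
  dx (u + v) = dx u + dx v.
Proof. by move=> du dv; apply/funext => p; exact: deriveD. Qed.

Lemma dyD u v : (forall p, derivable u p e2) -> (forall p, derivable v p e2) ->
  dy (u + v) = dy u + dy v.
Proof. by move=> du dv; apply/funext => p; exact: deriveD. Qed.

Lemma dxZ (k : R) u : (forall p, derivable u p e1) -> dx (k *: u) = k *: dx u.
Proof. by move=> du; apply/funext => p; exact: deriveZ. Qed.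

Lemma dyZ (k : R) u : (forall p, derivable u p e2) -> dy (k *: u) = k *: dy u.
Proof. by move=> du; apply/funext => p; exact: deriveZ. Qed.

Lemma dxM u v : (forall p, derivable u p e1) -> (forall p, derivable v p e1) ->
  dx (u * v) = u * dx v + v * dx u.
Proof. by move=> du dv; apply/funext => p; exact: deriveM. Qed.

Lemma dyM u v : (forall p, derivable u p e2) -> (forall p, derivable v p e2) ->
  dy (u * v) = u * dy v + v * dy u.
Proof. by move=> du dv; apply/funext => p; exact: deriveM. Qed.

Lemma CnS n u : Cn n.+1 u -> Cn n u.
Proof.
elim: n u => [u []//|n IHn u [cu dxu dyu nu mu]].
exact: And5 cu dxu dyu (IHn _ nu) (IHn _ mu).
Qed.

Lemma CnD n u v : Cn n u -> Cn n v -> Cn n (u + v).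
Proof.
elim: n u v => [u v cu cv p|n IHn u v [cu ux uy Cux Cuy] [cv vx vy Cvx Cvy]].
  by apply: continuousD; [exact: cu|exact: cv].
split.
- by move=> p; apply: continuousD; [exact: cu|exact: cv].
- by move=> p; exact: derivableD.
- by move=> p; exact: derivableD.
- by rewrite dxD//; exact: IHn.
- by rewrite dyD//; exact: IHn.
Qed.

Lemma CnZ n (k : R) u : Cn n u -> Cn n (k *: u).
Proof.
elim: n u => [u cu p|n IHn u [cu ux uy Cux Cuy]].
  by apply: continuousM; [exact: cst_continuous|exact: cu].
split.
- by move=> p; apply: continuousM; [exact: cst_continuous|exact: cu].
- by move=> p; exact: derivableZ.
- by move=> p; exact: derivableZ.
- by rewrite dxZ//; exact: IHn.
- by rewrite dyZ//; exact: IHn.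
Qed.

(** The product rule for order n.+1 multiplies a derivative, known to order n, by
the other factor itself, known to order n.+1; hence the use of [CnS]. *)
Lemma CnM n u v : Cn n u -> Cn n v -> Cn n (u * v).
Proof.
elim: n u v => [u v cu cv p|n IHn u v Cu Cv].
  by apply: continuousM; [exact: cu|exact: cv].
have [cu ux uy Cux Cuy] := Cu; have [cv vx vy Cvx Cvy] := Cv.
split.
- by move=> p; apply: continuousM; [exact: cu|exact: cv].
- by move=> p; exact: derivableM.
- by move=> p; exact: derivableM.
- by rewrite dxM//; apply: CnD; apply: IHn => //; exact: CnS.
- by rewrite dyM//; apply: CnD; apply: IHn => //; exact: CnS.
Qed.

Lemma Cn0 n : Cn n (0 : R * R -> R).
Proof.
have c0 : continuous (0 : R * R -> R) by move=> p; exact: cst_continuous.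
have d0 (p e : R * R) : derivable (0 : R * R -> R) p e by exact: derivable_cst.
have D0 (e : R * R) : 'D_e (0 : R * R -> R) = 0.
  by apply/funext => p; exact: derive_cst.
elim: n => // n IHn; split.
- exact: c0.
- by move=> p; exact: d0.
- by move=> p; exact: d0.
- by rewrite (_ : dx 0 = 0)//; exact: D0.
- by rewrite (_ : dy 0 = 0)//; exact: D0.
Qed.

Section smooth.
Variables (u : R * R -> R) (su : smooth u).

Lemma smooth_continuous : continuous u. Proof. exact: (su 0). Qed.

Lemma smooth_derivable_x p : derivable u p e1.
Proof. by have [_ + _ _ _] := su 1; exact. Qed.

Lemma smooth_derivable_y p : derivable u p e2.
Proof. by have [_ _ + _ _] := su 1; exact. Qed.

End smooth.

Variables a b c d : R.
Local Notation SP := (smooth_periodic a b c d).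

Lemma smooth_periodic0 : SP 0.
Proof. by split=> [n|p]; [exact: Cn0|]. Qed.

Lemma smooth_periodicD u v : SP u -> SP v -> SP (u + v).
Proof.
move=> [su pu] [sv pv]; split=> [n|p]; first exact: CnD.
have [pu1 pu2] := pu p; have [pv1 pv2] := pv p.
by rewrite !fctE pu1 pu2 pv1 pv2.
Qed.

Lemma smooth_periodicZ (k : R) u : SP u -> SP (k *: u).
Proof.
move=> [su pu]; split=> [n|p]; first exact: CnZ.
by have [pu1 pu2] := pu p; rewrite !fctE pu1 pu2.
Qed.

Lemma smooth_periodicM u v : SP u -> SP v -> SP (u * v).
Proof.
move=> [su pu] [sv pv]; split=> [n|p]; first exact: CnM.
have [pu1 pu2] := pu p; have [pv1 pv2] := pv p.
by rewrite !fctE pu1 pu2 pv1 pv2.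
Qed.

Let derive_periodic e u : Defs.periodic a b c d u ->
  Defs.periodic a b c d ('D_e u).
Proof.
move=> pu [x y] /=.
have -> : (x + (b - a), y) = (x, y) + (b - a, 0) :> R * R.
  by congr pair; rewrite /= addr0.
have -> : (x, y + (d - c)) = (x, y) + (0, d - c) :> R * R.
  by congr pair; rewrite /= addr0.
rewrite !derive_translate// => -[r s].
  by have [_ <-] := pu (r, s); congr (u (_, _)); rewrite /= addr0.
by have [<- _] := pu (r, s); congr (u (_, _)); rewrite /= addr0.
Qed.

Lemma smooth_periodic_dx u : SP u -> SP (dx u).
Proof.
move=> [su pu]; split; last exact: derive_periodic.
by move=> n; have [] := su n.+1.
Qed.

Lemma smooth_periodic_dy u : SP u -> SP (dy u).
Proof.
move=> [su pu]; split; last exact: derive_periodic.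
by move=> n; have [] := su n.+1.
Qed.

End smooth_periodic_functions.

(** * Integration by parts, the energy form and skew-symmetry *)

Section energy.
Context (R : realType) (a b c d : R).
Hypotheses (ab : a < b) (cd : c < d).
Implicit Types u v w : R * R -> R.
Local Notation SP := (smooth_periodic a b c d).
Local Notation inner := (inner a b c d).

Let cont u : SP u -> continuous u.
Proof. by move=> [su _]; exact: smooth_continuous. Qed.

Let derx u : SP u -> forall p, derivable u p e1.
Proof. by move=> [su _]; exact: smooth_derivable_x. Qed.

Let dery u : SP u -> forall p, derivable u p e2.
Proof. by move=> [su _]; exact: smooth_derivable_y. Qed.

Lemma innerE u v : inner u v = box_integral a b c d (u * v).
Proof. by []. Qed.

Lemma innerC u v : inner u v = inner v u.
Proof. by rewrite !innerE mulrC. Qed.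

Lemma innerDl u v w : SP u -> SP v -> SP w ->
  inner (u + v) w = inner u w + inner v w.
Proof.
move=> Su Sv Sw; rewrite !innerE mulrDl box_integralD//;
  by apply: cont; exact: smooth_periodicM.
Qed.

Lemma innerZl (k : R) u v : SP u -> SP v -> inner (k *: u) v = k * inner u v.
Proof.
move=> Su Sv; rewrite !innerE -box_integralZ.
  by congr box_integral; apply/funext => p; rewrite !fctE; exact/esym/mulrA.
by apply: cont; exact: smooth_periodicM.
Qed.

Lemma innerDr u v w : SP u -> SP v -> SP w ->
  inner u (v + w) = inner u v + inner u w.
Proof. by move=> Su Sv Sw; rewrite innerC innerDl// !(innerC u). Qed.

Lemma innerZr (k : R) u v : SP u -> SP v -> inner u (k *: v) = k * inner u v.
Proof. by move=> Su Sv; rewrite innerC innerZl// innerC. Qed.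

Lemma inner_lincomb (k l : R) u v x y : SP u -> SP v -> SP x -> SP y ->
  inner u (v + k *: x + l *: y) = inner u v + k * inner u x + l * inner u y.
Proof.
move=> Su Sv Sx Sy.
have [Skx Sly] := (smooth_periodicZ k Sx, smooth_periodicZ l Sy).
have Svkx := smooth_periodicD Sv Skx.
by rewrite (innerDr Su Svkx Sly) (innerDr Su Sv Skx) !innerZr.
Qed.

(** Integration by parts: the product is periodic, so the integral of its
derivative vanishes and leaves no boundary term. *)
Lemma inner_dx u v : SP u -> SP v -> inner (dx u) v = - inner u (dx v).
Proof.
move=> Su Sv; have Suv := smooth_periodicM Su Sv.
have Sdu := smooth_periodic_dx Su; have Sdv := smooth_periodic_dx Sv.
have := box_integral_dx ab Suv.2 (derx Suv) (cont Suv)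
  (cont (smooth_periodic_dx Suv)).
rewrite (dxM (derx Su) (derx Sv)) box_integralD; first last.
- by apply: cont; exact: smooth_periodicM.
- by apply: cont; exact: smooth_periodicM.
rewrite -!innerE addrC => /eqP; rewrite addr_eq0 => /eqP <-.
exact: innerC.
Qed.

Lemma inner_dy u v : SP u -> SP v -> inner (dy u) v = - inner u (dy v).
Proof.
move=> Su Sv; have Suv := smooth_periodicM Su Sv.
have Sdu := smooth_periodic_dy Su; have Sdv := smooth_periodic_dy Sv.
have := box_integral_dy cd Suv.2 (dery Suv) (cont Suv)
  (cont (smooth_periodic_dy Suv)).
rewrite (dyM (dery Su) (dery Sv)) box_integralD; first last.
- by apply: cont; exact: smooth_periodicM.
- by apply: cont; exact: smooth_periodicM.
rewrite -!innerE addrC => /eqP; rewrite addr_eq0 => /eqP <-.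
exact: innerC.
Qed.

Let opDE (mu theta : R) v :
  opD mu theta v = v + (- mu) *: dx (dx v) + (- theta) *: dy (dy v).
Proof. by apply/funext => p; rewrite /opD !fctE /GRing.scale/=; ring. Qed.

Lemma smooth_periodic_opD (mu theta : R) v : SP v -> SP (opD mu theta v).
Proof.
move=> Sv; rewrite opDE.
have Sxx := smooth_periodic_dx (smooth_periodic_dx Sv).
have Syy := smooth_periodic_dy (smooth_periodic_dy Sv).
exact: smooth_periodicD
  (smooth_periodicD Sv (smooth_periodicZ _ Sxx)) (smooth_periodicZ _ Syy).
Qed.

Lemma inner_opD (mu theta : R) u v : SP u -> SP v ->
  inner u (opD mu theta v) =
  inner u v + mu * inner (dx u) (dx v) + theta * inner (dy u) (dy v).
Proof.
move=> Su Sv.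
have Sx := smooth_periodic_dx Sv; have Sxx := smooth_periodic_dx Sx.
have Sy := smooth_periodic_dy Sv; have Syy := smooth_periodic_dy Sy.
rewrite opDE [LHS](inner_lincomb _ _ Su Sv Sxx Syy).
have hx := inner_dx Su Sx; have hy := inner_dy Su Sy.
by rewrite hx hy !mulNr !mulrN.
Qed.

(** The cancellation behind the skew-symmetry of G, with f, g standing for the
derivatives of v and p, p', q, q' for the two halves of each nonlinear term. *)
Lemma inner_skew_lincomb (k1 k2 k3 k4 : R) v f g p p' q q' :
  SP v -> SP f -> SP g -> SP p -> SP p' -> SP q -> SP q' ->
  inner v f = 0 -> inner v g = 0 ->
  inner v p' = - inner v p -> inner v q' = - inner v q ->
  inner v (k1 *: f + k2 *: g + k3 *: (p + p') + k4 *: (q + q')) = 0.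
Proof.
move=> Sv Sf Sg Sp Sp' Sq Sq' vf vg vp vq.
have Sfg := smooth_periodicD (smooth_periodicZ k1 Sf) (smooth_periodicZ k2 Sg).
have [Spp Sqq] := (smooth_periodicD Sp Sp', smooth_periodicD Sq Sq').
rewrite inner_lincomb// !innerDr ?innerZr//; try exact: smooth_periodicZ.
by rewrite vf vg vp vq !subrr !mulr0 !addr0.
Qed.

(** Moving the derivative off w v turns (v, dx (w v)) into -(v, w dx v), which
cancels the other half of the nonlinear term; the linear terms vanish because
dx and dy are skew. *)
Lemma inner_opG_skew (alpha beta : R) w v : SP w -> SP v ->
  inner v (opG alpha beta w v) = 0.
Proof.
move=> Sw Sv.
have Swv := smooth_periodicM Sw Sv.
have Sx := smooth_periodic_dx Sv; have Sy := smooth_periodic_dy Sv.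
have Swx := smooth_periodicM Sw Sx; have Swy := smooth_periodicM Sw Sy.
have Sdx := smooth_periodic_dx Swv; have Sdy := smooth_periodic_dy Swv.
have -> : opG alpha beta w v =
    (- alpha) *: dx v + (- beta) *: dy v +
    (- (alpha / 3)) *: (w * dx v + dx (w * v)) +
    (- (beta / 3)) *: (w * dy v + dy (w * v)).
  by apply/funext => p; rewrite /opG !fctE /GRing.scale/=; ring.
have assoc u : inner v (w * u) = inner (w * v) u.
  by rewrite !innerE mulrCA mulrA.
have self_opp (r : R) : r = - r -> r = 0 by move=> rNr; lra.
apply: inner_skew_lincomb => //; rewrite ?assoc.
- exact: self_opp (etrans (innerC _ _) (inner_dx Sv Sv)).
- exact: self_opp (etrans (innerC _ _) (inner_dy Sv Sv)).
- exact: etrans (innerC _ _) (inner_dx Swv Sv).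
- exact: etrans (innerC _ _) (inner_dy Swv Sv).
Qed.

Lemma inner_opDC (mu theta : R) u v : SP u -> SP v ->
  inner u (opD mu theta v) = inner v (opD mu theta u).
Proof.
move=> Su Sv.
rewrite [LHS](inner_opD mu theta Su Sv) [RHS](inner_opD mu theta Sv Su).
have [C Cx Cy] :=
  And3 (innerC u v) (innerC (dx u) (dx v)) (innerC (dy u) (dy v)).
by rewrite C Cx Cy.
Qed.

End energy.

(** * Runge-Kutta methods that preserve quadratic forms *)

Section runge_kutta_quadratic_invariant.
Context (R : realType) (V : lmodType R) (S : set V) (B : V -> V -> R).
Hypotheses (S0 : S 0) (SD : forall x y, S x -> S y -> S (x + y))
  (SZ : forall k x, S x -> S (k *: x)).
Hypotheses (BC : forall x y, S x -> S y -> B x y = B y x)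
  (BDl : forall x y z, S x -> S y -> S z -> B (x + y) z = B x z + B y z)
  (BZl : forall k x y, S x -> S y -> B (k *: x) y = k * B x y).

Lemma submod_sum n (k : 'I_n -> R) (x : 'I_n -> V) : (forall i, S (x i)) ->
  S (\sum_(i < n) k i *: x i).
Proof.
by move=> Sx; apply: (big_ind S) => // i _; exact: SZ.
Qed.

(** B is linear on S only, so the induction carries along the membership in S of
the partial sums. *)
Lemma form_suml n (k : 'I_n -> R) (x : 'I_n -> V) y :
  (forall i, S (x i)) -> S y ->
  B (\sum_(i < n) k i *: x i) y = \sum_(i < n) k i * B (x i) y.
Proof.
move=> Sx Sy.
pose rel v (r : R) := S v /\ B v y = r.
suff [] : rel (\sum_(i < n) k i *: x i) (\sum_(i < n) k i * B (x i) y) by [].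
elim/big_rec2: _ => [|i r v _ [Sv <-]]; split=> //.
- by have := BZl 0 S0 Sy; rewrite scale0r mul0r.
- by apply: SD => //; exact: SZ.
- by rewrite BDl ?BZl//; exact: SZ.
Qed.

(** With X = sum_i w_i K_i, the increment of the form is
2 tau B(X, u) + tau^2 B(X, X).  Stage orthogonality eliminates u: B(K_i, u) =
- tau sum_j A_ij B(K_i, K_j).  The coefficient of B(K_i, K_j) in the increment
is then tau^2 (w_i w_j - 2 w_i A_ij), and its symmetrization in (i, j), all that
counts for a symmetric form, is zero by the condition on the coefficients. *)
Lemma runge_kutta_form_conserved s (A : 'M[R]_s) (w : 'I_s -> R) (tau : R)
    (u : V) (K : 'I_s -> V) :
  (forall i j, w i * A i j + w j * A j i = w i * w j) ->
  S u -> (forall i, S (K i)) ->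
  (forall i, B (K i) (u + tau *: \sum_(j < s) A i j *: K j) = 0) ->
  let u' := u + tau *: \sum_(i < s) w i *: K i in B u' u' = B u u.
Proof.
move=> wA Su SK BK0 u'.
set X := \sum_(i < s) w i *: K i in u' *.
have SX : S X by exact: submod_sum.
have StX : S (tau *: X) by exact: SZ.
have Ku i : B (K i) u = - tau * \sum_(j < s) A i j * B (K i) (K j).
  have SY := submod_sum (A i) SK; have := BK0 i.
  rewrite BC//; last by apply: SD => //; exact: SZ.
  rewrite BDl//; last exact: SZ.
  rewrite BZl// form_suml// (BC Su)// => /eqP.
  rewrite addr_eq0 mulNr => /eqP ->; congr (- (_ * _)).
  by apply: eq_bigr => j _; rewrite BC.
have Xu : B X u = - tau * \sum_(i < s) \sum_(j < s) w i * A i j * B (K i) (K j).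
  rewrite form_suml// mulr_sumr; apply: eq_bigr => i _.
  by rewrite Ku mulrCA mulr_sumr; under eq_bigr do rewrite mulrA.
have XX : B X X = \sum_(i < s) \sum_(j < s) w i * w j * B (K i) (K j).
  rewrite form_suml//; apply: eq_bigr => i _.
  rewrite BC// form_suml// mulr_sumr; apply: eq_bigr => j _.
  by rewrite mulrA BC.
(* The condition on A and w, summed against the symmetric B (K i) (K j). *)
have XX2 : B X X =
    2 * \sum_(i < s) \sum_(j < s) w i * A i j * B (K i) (K j).
  transitivity (\sum_(i < s) \sum_(j < s) w i * A i j * B (K i) (K j) +
                \sum_(i < s) \sum_(j < s) w j * A j i * B (K j) (K i)).
    rewrite XX -big_split; apply: eq_bigr => i _.
    rewrite -big_split; apply: eq_bigr => j _ /=.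
    by rewrite -wA mulrDl (BC (SK j)).
  by rewrite [X in _ + X]exchange_big/= mulr2n mulrDl mul1r.
have Su' : S u' by exact: SD.
rewrite {1}/u' BDl// BZl// !(BC _ Su')//.
rewrite /u' !(BDl, BZl)// (BC Su SX) XX2 Xu; ring.
Qed.

End runge_kutta_quadratic_invariant.

(** * The stages of the scheme *)

Lemma pinv_dflt T U (dflt : U -> T) (D : set T) (f : T -> U) y :
  ~ (f @` D) y -> 'pinv_dflt D f y = dflt y.
Proof.
by move=> nDy; rewrite /pinv_ splitV oinv_surj; case: pselect.
Qed.

Section scheme.
Context (R : realType) (a b c d : R).
Local Notation SP := (smooth_periodic a b c d).

(** Holds for every f, in the image of D or not, since 0 is itself smooth and
periodic; this is what makes the predicted stages smooth and periodic. *)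
Lemma opDinv_smooth_periodic (mu theta : R) f : SP (opDinv a b c d mu theta f).
Proof.
have [fD|fND] := pselect ((opD mu theta @` SP) f).
  have := @surjpinv_image_sub _ _ (fun=> 0) SP (opD mu theta @` SP) (opD mu theta).
  by apply; [exact: subset_refl|exists f].
by rewrite /opDinv pinv_dflt//; exact: smooth_periodic0.
Qed.

Lemma rk_stage_smooth_periodic s (A : 'M[R]_s) (tau : R) u k i :
  SP u -> (forall j, SP (k j)) -> SP (rk_stage A tau u k i).
Proof.
move=> Su Sk; apply: smooth_periodicD => //; apply: smooth_periodicZ.
apply: (submod_sum (S := SP)) => //.
- exact: smooth_periodic0.
- exact: smooth_periodicD.
- exact: smooth_periodicZ.
Qed.

Lemma predicted_stage_smooth_periodic (alpha beta mu theta : R) s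
    (A : 'M[R]_s) (tau : R) u M i : SP u ->
  SP (predicted_stage a b c d alpha beta mu theta A tau u M i).
Proof.
move=> Su; apply: rk_stage_smooth_periodic => // j.
by case: M => [//|M]; exact: opDinv_smooth_periodic.
Qed.

Hypotheses (ab : a < b) (cd : c < d).

(** If G(w) v is in the image of D this is the skew-symmetry of G(w); otherwise
D^-1 G(w) v is the zero function, and symmetry moves D to the other factor. *)
Lemma inner_opD_opDinv_skew (alpha beta mu theta : R) w v : SP w -> SP v ->
  inner a b c d v (opD mu theta (opDinv a b c d mu theta (opG alpha beta w v)))
  = 0.
Proof.
move=> Sw Sv; set f := opG _ _ _ _.
have [fD|fND] := pselect ((opD mu theta @` SP) f).
  rewrite /opDinv pinvK; first exact: inner_opG_skew.
  by rewrite inE.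
rewrite /opDinv pinv_dflt//.
have S0 := smooth_periodic0 a b c d.
apply: etrans (inner_opDC ab cd mu theta Sv S0) _.
have := innerZl 0 S0 (smooth_periodic_opD mu theta Sv).
by rewrite scale0r mul0r.
Qed.
End scheme.

Theorem theorem2p2 (R : realType) (a b c d : R) (hab : a < b) (hcd : c < d)
  (alpha beta mu theta : R) (hmu : 0 < mu) (htheta : 0 < theta)
  (s : nat) (hs : (0 < s)%N) (A : 'M[R]_s) (w nodes : 'I_s -> R)
  (hnodes : forall i, nodes i = \sum_(j < s) A i j)
  (nodes_inj : injective nodes)
  (hA : forall i j, w i * A i j + w j * A j i = w i * w j)
  (M : nat) (hM : (0 < M)%N) (tau : R) (htau : 0 < tau)
  (u : nat -> R * R -> R) (U K : nat -> 'I_s -> R * R -> R)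
  (hu : forall n, smooth_periodic a b c d (u n))
  (hU : forall n i, smooth_periodic a b c d (U n i))
  (hK : forall n i, smooth_periodic a b c d (K n i))
  (hscheme : prediction_correction a b c d alpha beta mu theta A w tau M u U K) :
  forall n, momentum a b c d mu theta (u n.+1) = momentum a b c d mu theta (u n).
Proof.
move=> n; have [Kdef Udef ->] := hscheme n.
apply: (congr1 ( *%R 2^-1)).
apply: (@runge_kutta_form_conserved _ _ (smooth_periodic a b c d)
  (fun v v' => inner a b c d v (opD mu theta v'))
  _ _ _ _ _ _ _ _ _ _ _ _ hA (hu n) (hK n)).
- exact: smooth_periodic0.
- exact: smooth_periodicD.
- exact: smooth_periodicZ.
- by move=> x y; exact: inner_opDC.
- by move=> x y z Sx Sy Sz; exact: innerDl Sx Sy (smooth_periodic_opD _ _ Sz).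
- by move=> k x y Sx Sy; exact: innerZl _ Sx (smooth_periodic_opD _ _ Sy).
- move=> i; rewrite -/(rk_stage A tau (u n) (K n) i) -Udef.
  apply: etrans (inner_opDC hab hcd mu theta (hK n i) (hU n i)) _.
  rewrite Kdef; apply: inner_opD_opDinv_skew (hU n i) => //.
  exact: predicted_stage_smooth_periodic.
Qed.
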